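(* For every commutative compact semisimple symmetric triad $(\mathfrak{g},\theta_1,\theta_2)$, the following relations hold: $$(\mathfrak{g},\theta_1,\theta_2)^{a*}=(\mathfrak{g},\theta_1,\theta_2)^{*a},\qquad (\mathfrak{g},\theta_1,\theta_2)^{d*}=(\mathfrak{g},\theta_1,\theta_2)^{*d}.$$ (Superscripts are applied from left to right, e.g. $x^{a*}=(x^a)^*$.)
   Context: An involution on a real Lie algebra $\mathfrak{l}$ is an automorphism $\nu$ with $\nu^2=\operatorname{id}$; $\mathfrak{l}^{\pm\nu}$ are its $(\pm1)$-eigenspaces. Involutions are extended $\mathbb{C}$-linearly to complexifications and restricted to real forms, keeping the same letter; the complexification of a real form of $\mathfrak{g}_{\mathbb{C}}$ is identified with $\mathfrak{g}_{\mathbb{C}}$. A commutative compact semisimple symmetric triad $(\mathfrak{g},\theta_1,\theta_2)$ consists of a compact semisimple Lie algebra $\mathfrak{g}$ and involutions $\theta_1,\theta_2$ on $\mathfrak{g}$ with $\theta_1\theta_2=\theta_2\theta_1$. Its associated triad is $(\mathfrak{g},\theta_1,\theta_2)^a:=(\mathfrak{g},\theta_1,\theta_1\theta_2)$ and its dual triad is $(\mathfrak{g},\theta_1,\theta_2)^d:=(\mathfrak{g},\theta_2,\theta_1)$. A non-compact semisimple symmetric pair equipped with a Cartan involution $(\mathfrak{g}_0,\sigma;\theta)$ consists of a non-compact real semisimple Lie algebra $\mathfrak{g}_0$, an involution $\sigma$ on it, and a Cartan involution $\theta$ of $\mathfrak{g}_0$ with $\theta\sigma=\sigma\theta$. Its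 associated pair is $(\mathfrak{g}_0,\sigma;\theta)^a:=(\mathfrak{g}_0,\theta\sigma;\theta)$ and its dual pair is $(\mathfrak{g}_0,\sigma;\theta)^d:=(\mathfrak{g}_0^d,\theta;\sigma)$, where $\mathfrak{g}_0^d:=(\mathfrak{g}_0)_{\mathbb{C}}^{\mu\sigma}$ is the fixed point set of $\mu\sigma$, with $\mu$ the complex conjugation of $(\mathfrak{g}_0)_{\mathbb{C}}$ with respect to the compact real form $\mathfrak{g}_0^{\theta}+\sqrt{-1}\,\mathfrak{g}_0^{-\theta}$. The duality $*$ from triads to pairs equipped with Cartan involutions is $(\mathfrak{g},\theta_1,\theta_2)^*:=(\mathfrak{g}^{\theta_1}+\sqrt{-1}\,\mathfrak{g}^{-\theta_1},\ \theta_2;\ \theta_1)$. *)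

(* Defs.v *)
From HB Require Import structures.
From mathcomp Require Import all_boot all_order all_algebra.
From mathcomp Require Import boolp reals.
From mathcomp Require Import ring lra.

Set Implicit Arguments.
Unset Strict Implicit.
Unset Printing Implicit Defensive.

Import Order.TTheory GRing.Theory Num.Theory.
Local Open Scope ring_scope.

HB.mixin Record isLieAlgebra (K : fieldType) L of Vector K L := {
  bracket : L -> L -> L;
  bracket_is_linearl : forall z a x y,
    bracket (a *: x + y) z = a *: bracket x z + bracket y z;
  bracket_is_linearr : forall z a x y,
    bracket z (a *: x + y) = a *: bracket z x + bracket z y;
  bracketxx : forall x, bracket x x = 0;
  jacobi : forall x y z,
    bracket x (bracket y z) + bracket y (bracket z x)
      + bracket z (bracket x y) = 0
}.

#[short(type="lieAlgType")]
HB.structure Definition LieAlgebra (K : fieldType) :=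
  { L of isLieAlgebra K L & Vector K L }.

(* A complex Lie algebra is encoded as the underlying real Lie algebra together
   with its complex structure 'J, i.e. multiplication by sqrt(-1).  Thus linear
   maps, subspaces and Killing forms of such an algebra are real ones, and
   C-linear means R-linear and commuting with 'J. *)
HB.mixin Record hasComplexStructure (R : realType) M of LieAlgebra R M := {
  cstruct : 'End(M);
  cstructK : forall x, cstruct (cstruct x) = - x;
  bracketJl : forall x y : M, bracket (cstruct x) y = cstruct (bracket x y)
}.

#[short(type="cplxLieAlgType")]
HB.structure Definition ComplexLieAlgebra (R : realType) :=
  { M of hasComplexStructure R M & LieAlgebra R M }.

Notation "''J'" := cstruct : ring_scope.

Section LieTheory.
Variables (K : fieldType) (L : lieAlgType K).
Implicit Types x y z : L.

HB.instance Definition _ x :=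
  GRing.isLinear.Build K L L *:%R (bracket x) (bracket_is_linearr x).

Definition bracketr y : L -> L := fun x => bracket x y.
HB.instance Definition _ y :=
  GRing.isLinear.Build K L L *:%R (bracketr y) (bracket_is_linearl y).

Lemma bracketDl x y z : bracket (x + y) z = bracket x z + bracket y z.
Proof. exact: (raddfD (bracketr z)). Qed.
Lemma bracketNl x z : bracket (- x) z = - bracket x z.
Proof. exact: (raddfN (bracketr z)). Qed.
Lemma bracketDr x y z : bracket x (y + z) = bracket x y + bracket x z.
Proof. exact: raddfD. Qed.
Lemma bracketNr x z : bracket x (- z) = - bracket x z.
Proof. exact: raddfN. Qed.

Lemma bracketC x y : bracket x y = - bracket y x.
Proof.
have := bracketxx (x + y).
rewrite bracketDl !bracketDr !bracketxx add0r addr0 => /eqP.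
by rewrite addr_eq0 => /eqP.
Qed.

Definition ad x : 'End(L) := linfun (bracket x).

Lemma adE x y : ad x y = bracket x y. Proof. by rewrite lfunE. Qed.

End LieTheory.

Section Trace.
Variable K : fieldType.

Definition lfun_trace (V : vectType K) (f : 'End(V)) : K :=
  \sum_(i < \dim {:V}) coord (vbasis {:V}) i (f (vbasis {:V})`_i).

Lemma lfun_traceD (V : vectType K) (f g : 'End(V)) :
  lfun_trace (f + g) = lfun_trace f + lfun_trace g.
Proof. by rewrite -big_split; apply: eq_bigr => i _; rewrite lfunE linearD. Qed.

Lemma lfun_traceN (V : vectType K) (f : 'End(V)) :
  lfun_trace (- f) = - lfun_trace f.
Proof. by rewrite -sumrN; apply: eq_bigr => i _; rewrite lfunE linearN. Qed.

Lemma lfun_traceC (V W : vectType K) (f : 'Hom(V, W)) (g : 'Hom(W, V)) :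
  lfun_trace (g \o f)%VF = lfun_trace (f \o g)%VF.
Proof.
pose F (i : 'I_(\dim {:V})) (j : 'I_(\dim {:W})) := coord (vbasis {:V}) i (g (vbasis {:W})`_j)
              * coord (vbasis {:W}) j (f (vbasis {:V})`_i).
transitivity (\sum_i \sum_j F i j).
  apply: eq_bigr => i _; rewrite lfunE /=.
  rewrite {1}(coord_vbasis (memvf (f (vbasis {:V})`_i))) !linear_sum.
  by apply: eq_bigr => j _; rewrite !linearZ /= mulrC.
rewrite exchange_big; apply: eq_bigr => j _; rewrite lfunE /=.
rewrite {1}(coord_vbasis (memvf (g (vbasis {:W})`_j))) !linear_sum.
by apply: eq_bigr => i _; rewrite !linearZ /=.
Qed.

End Trace.

Section Killing.
Variables (K : fieldType) (L : lieAlgType K).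

Definition killing (x y : L) : K := lfun_trace (ad x \o ad y)%VF.

Lemma killingC x y : killing x y = killing y x.
Proof. exact: lfun_traceC. Qed.

Lemma killingDl x y z : killing (x + y) z = killing x z + killing y z.
Proof.
rewrite /killing -lfun_traceD; congr lfun_trace; apply/lfunP => v.
by rewrite add_lfunE !comp_lfunE !adE bracketDl.
Qed.
Lemma killingNl x z : killing (- x) z = - killing x z.
Proof.
rewrite /killing -lfun_traceN; congr lfun_trace; apply/lfunP => v.
by rewrite opp_lfunE !comp_lfunE !adE bracketNl.
Qed.
Lemma killingDr x y z : killing x (y + z) = killing x y + killing x z.
Proof. by rewrite killingC killingDl !(killingC x). Qed.
Lemma killingNr x z : killing x (- z) = - killing x z.
Proof. by rewrite killingC killingNl (killingC x). Qed.

Lemma killing0 : killing 0 0 = 0.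
Proof. by apply: (addIr (killing 0 0)); rewrite -killingDl addr0 add0r. Qed.

(* The Killing form is nondegenerate. *)
Definition semisimple := forall x : L, (forall y, killing x y = 0) -> x = 0.

(* Bijectivity is a consequence of [inv_square]. *)
Record involution := Involution {
  inv_fun :> 'End(L);
  inv_bracket : forall x y,
    inv_fun (bracket x y) = bracket (inv_fun x) (inv_fun y);
  inv_square : forall x, inv_fun (inv_fun x) = x
}.

Definition plus_space (nu : 'End(L)) : {vspace L} := lker (nu - \1%VF).
Definition minus_space (nu : 'End(L)) : {vspace L} := lker (nu + \1%VF).

Lemma plus_spaceP (nu : 'End(L)) x : reflect (nu x = x) (x \in plus_space nu).
Proof.
by rewrite memv_ker !lfunE /= opp_lfunE id_lfunE subr_eq0; apply: eqP.
Qed.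
Lemma minus_spaceP (nu : 'End(L)) x : reflect (nu x = - x) (x \in minus_space nu).
Proof.
by rewrite memv_ker !lfunE /= id_lfunE addr_eq0; apply: eqP.
Qed.

Lemma involution_eq (nu nu' : involution) : (forall x, nu x = nu' x) -> nu = nu'.
Proof.
case: nu nu' => [f fb f2] [g gb g2] /= E.
have e : f = g by apply/lfunP.
by subst g; congr Involution; apply: Prop_irrelevance.
Qed.

Section Comp.
Variables (nu nu' : involution) (comm : (nu \o nu' = nu' \o nu)%VF).

Lemma commE x : nu (nu' x) = nu' (nu x).
Proof. by have /lfunP/(_ x) := comm; rewrite !comp_lfunE. Qed.

Lemma inv_comp_bracket x y :
  (nu \o nu')%VF (bracket x y)
    = bracket ((nu \o nu')%VF x) ((nu \o nu')%VF y).
Proof. by rewrite !comp_lfunE !inv_bracket. Qed.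
Lemma inv_comp_square x : (nu \o nu')%VF ((nu \o nu')%VF x) = x.
Proof. by rewrite !comp_lfunE -commE inv_square inv_square. Qed.

Definition inv_comp : involution := Involution inv_comp_bracket inv_comp_square.

End Comp.

Lemma inv_comp_comm (nu nu' : involution) (comm : (nu \o nu' = nu' \o nu)%VF) :
  (nu \o inv_comp comm = inv_comp comm \o nu)%VF.
Proof. by rewrite /= {1}comm comp_lfunA. Qed.

End Killing.

Section Real.
Variables (R : realType) (L : lieAlgType R).

(* Compact and semisimple: the Killing form is negative definite. *)
Definition compact_semisimple := forall x : L, x != 0 -> killing x x < 0.

Definition cartan_involution (theta : involution L) :=
  forall x : L, x != 0 -> 0 < - killing x (theta x).

Lemma cartan_semisimple theta : cartan_involution theta -> semisimple L.
Proof.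
move=> ct x kx; apply/eqP; apply/negPn/negP => /ct.
by rewrite kx oppr0 ltxx.
Qed.

End Real.

Section RealForm.
Variables (R : realType) (M : cplxLieAlgType R).
Implicit Types (U : {vspace M}) (x y z : M).

Lemma bracketJr x y : bracket x ('J y) = 'J (bracket x y).
Proof. by rewrite bracketC bracketJl -linearN -bracketC. Qed.

Lemma bracketCE x y x' y' : bracket (x + 'J y) (x' + 'J y') =
  bracket x x' - bracket y y' + 'J (bracket x y' + bracket y x').
Proof.
rewrite bracketDl !bracketDr !bracketJl !bracketJr cstructK linearD /=.
by rewrite -!addrA; congr +%R; rewrite addrA addrC.
Qed.

Definition is_real_form U :=
  (U + 'J @: U = fullv)%VS /\ (U :&: 'J @: U = 0)%VS.

(* x + 'J y |-> x - 'J y for x and y in the real form U. *)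
Definition conjugation U : 'End(M) :=
  daddv_pi U ('J @: U) - daddv_pi ('J @: U) U.

Record real_form := RealForm {
  rf_space :> {vspace M};
  rf_bracket : forall x y,
    x \in rf_space -> y \in rf_space -> bracket x y \in rf_space;
  rf_real : is_real_form rf_space
}.

Lemma real_form_eq (U V : real_form) : U = V :> {vspace M} -> U = V.
Proof.
case: U V => [U cU rU] [V cV rV] /= e; subst V.
by congr RealForm; apply: Prop_irrelevance.
Qed.

Definition rf_lie (U : real_form) : Type := subvs_of U.

Section Form.
Variable U : real_form.

HB.instance Definition _ := Vector.on (rf_lie U).

Definition rf_brk (x y : rf_lie U) : rf_lie U :=
  vsproj U (bracket (vsval x) (vsval y)).

Lemma val_rf_brk (x y : rf_lie U) : vsval (rf_brk x y) = bracket (vsval x) (vsval y).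
Proof. by rewrite vsprojK // rf_bracket ?subvsP. Qed.

Fact rf_brk_linearl (z : rf_lie U) a (x y : rf_lie U) :
  rf_brk (a *: x + y) z = a *: rf_brk x z + rf_brk y z.
Proof.
apply: subvs_inj; rewrite linearP /= !val_rf_brk linearP /=.
exact: bracket_is_linearl.
Qed.
Fact rf_brk_linearr (z : rf_lie U) a (x y : rf_lie U) :
  rf_brk z (a *: x + y) = a *: rf_brk z x + rf_brk z y.
Proof. by apply: subvs_inj; rewrite linearP /= !val_rf_brk !linearP. Qed.
Fact rf_brkxx (x : rf_lie U) : rf_brk x x = 0.
Proof. by apply: subvs_inj; rewrite val_rf_brk bracketxx linear0. Qed.
Fact rf_jacobi (x y z : rf_lie U) :
  rf_brk x (rf_brk y z) + rf_brk y (rf_brk z x) + rf_brk z (rf_brk x y) = 0.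
Proof. by apply: subvs_inj; rewrite !linearD /= !val_rf_brk jacobi. Qed.

HB.instance Definition _ := isLieAlgebra.Build R (rf_lie U)
  rf_brk_linearl rf_brk_linearr rf_brkxx rf_jacobi.

Lemma val_bracket (x y : rf_lie U) :
  vsval (bracket x y) = bracket (vsval x) (vsval y).
Proof. exact: val_rf_brk. Qed.

Lemma rf_decomp z : exists x y, [/\ x \in U, y \in U & z = x + 'J y].
Proof.
have [UJ _] := rf_real U.
have : z \in (U + 'J @: U)%VS by rewrite UJ memvf.
by case/memv_addP=> x xU [_ /memv_imgP[y yU ->] ->]; exists x, y.
Qed.

Lemma conjugationE x y : x \in U -> y \in U ->
  conjugation U (x + 'J y) = x - 'J y.
Proof.
move=> xU yU; have [UJ dUJ] := rf_real U.
have JyU : 'J y \in ('J @: U)%VS by apply: memv_img.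
have dJU : ('J @: U :&: U = 0)%VS by rewrite capvC.
have p0 V W (v : M) : (V :&: W = 0)%VS -> v \in V -> daddv_pi W V v = 0.
  move=> d vV; have := daddv_pi_add d (subvP (addvSl V W) _ vV).
  by rewrite daddv_pi_id // => /(canRL (addKr _)); rewrite addNr.
rewrite /conjugation !linearD /= !add_lfunE !opp_lfunE.
rewrite (daddv_pi_id dUJ xU) (p0 _ _ _ dUJ xU).
by rewrite (daddv_pi_id dJU JyU) (p0 _ _ _ dJU JyU) subr0 add0r.
Qed.

Lemma conjugation_bracket x y :
  conjugation U (bracket x y) = bracket (conjugation U x) (conjugation U y).
Proof.
have [a [b [aU bU ->]]] := rf_decomp x; have [c [d [cU dU ->]]] := rf_decomp y.
rewrite !conjugationE //.
rewrite bracketCE conjugationE ?(memvB, memvD) ?rf_bracket //.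
rewrite -!linearN bracketCE !bracketNl !bracketNr !opprK -opprD.
by rewrite linearN.
Qed.

Lemma conjugationJ x : conjugation U ('J x) = - 'J (conjugation U x).
Proof.
have [a [b [aU bU ->]]] := rf_decomp x.
rewrite conjugationE // linearD /= cstructK addrC conjugationE ?memvN //.
by rewrite linearB /= cstructK opprK opprD addrC.
Qed.

Lemma conjugationK x : conjugation U (conjugation U x) = x.
Proof.
have [a [b [aU bU ->]]] := rf_decomp x.
by rewrite conjugationE // -linearN conjugationE ?memvN // linearN opprK.
Qed.

Section Restriction.
Variables (nu : involution M) (nuU : forall x, x \in U -> nu x \in U).

Definition res_fun : 'End(rf_lie U) :=
  (linfun (vsproj U) \o nu \o linfun vsval)%VF.

Lemma val_res (x : rf_lie U) : vsval (res_fun x) = nu (vsval x).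
Proof. by rewrite !comp_lfunE !lfunE /= vsprojK ?nuU ?subvsP. Qed.

Fact res_bracket (x y : rf_lie U) : res_fun (bracket x y) = bracket (res_fun x) (res_fun y).
Proof.
by apply: subvs_inj; rewrite val_res !val_bracket inv_bracket !val_res.
Qed.
Fact res_square (x : rf_lie U) : res_fun (res_fun x) = x.
Proof. by apply: subvs_inj; rewrite !val_res inv_square. Qed.

Definition restriction : involution (rf_lie U) :=
  Involution res_bracket res_square.

Lemma val_restriction (x : rf_lie U) : vsval (restriction x) = nu (vsval x).
Proof. exact: val_res. Qed.

End Restriction.

Lemma restriction_comm (nu nu' : involution M)
    (nuU : forall x, x \in U -> nu x \in U)
    (nuU' : forall x, x \in U -> nu' x \in U) :
    (forall z, nu (nu' z) = nu' (nu z)) ->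
  (restriction nuU \o restriction nuU' = restriction nuU' \o restriction nuU)%VF.
Proof.
move=> c; apply/lfunP => x; apply: subvs_inj.
rewrite [LHS](congr1 vsval (comp_lfunE (restriction nuU) _ x)).
rewrite [RHS](congr1 vsval (comp_lfunE (restriction nuU') _ x)).
by rewrite !val_restriction c.
Qed.

End Form.

(* The fixed points of an antilinear involutive automorphism form a real form. *)
Section Fixed.
Variables (tau : 'End(M))
  (tau_bracket : forall x y, tau (bracket x y) = bracket (tau x) (tau y))
  (tauJ : forall x, tau ('J x) = - 'J (tau x))
  (tauK : forall x, tau (tau x) = x).

Fact fixed_bracket x y : x \in plus_space tau -> y \in plus_space tau ->
  bracket x y \in plus_space tau.
Proof.
move=> /plus_spaceP xt /plus_spaceP yt; apply/plus_spaceP.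
by rewrite tau_bracket xt yt.
Qed.

Fact fixed_real : is_real_form (plus_space tau).
Proof.
split.
  apply/vspaceP => z; rewrite memvf.
  have -> : z = (2%:R^-1 *: (z + tau z)) +
                'J (2%:R^-1 *: ('J (tau z) - 'J z)).
    rewrite linearZ linearB /= !cstructK opprK -scalerDr.
    rewrite [_ + z]addrC addrACA subrr addr0 -mulr2n -scaler_nat scalerA.
    by rewrite mulVf ?scale1r ?pnatr_eq0.
  apply: memv_add; [|apply: memv_img]; apply/plus_spaceP.
    by rewrite linearZ linearD /= tauK addrC.
  by rewrite linearZ linearB /= !tauJ tauK opprK addrC.
apply/eqP; rewrite -subv0; apply/subvP => z.
rewrite memv_cap => /andP[/plus_spaceP tz /memv_imgP[y /plus_spaceP ty zE]].
move: tz; rewrite zE tauJ ty => /eqP; rewrite eq_sym -addr_eq0 -mulr2n.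
by rewrite -scaler_nat scaler_eq0 pnatr_eq0 /= memv0.
Qed.

Definition fixed_form : real_form := RealForm fixed_bracket fixed_real.

End Fixed.

End RealForm.

(* The data of an identification of the complexification of L with M. *)
Record complexification (R : realType) (L : lieAlgType R)
    (M : cplxLieAlgType R) := Complexification {
  cemb :> 'Hom(L, M);
  cemb_bracket : forall x y, cemb (bracket x y) = bracket (cemb x) (cemb y);
  cemb_inj : injective cemb;
  cemb_real : is_real_form (limg cemb)
}.

Section Complexification.
Variables (R : realType) (L : lieAlgType R) (M : cplxLieAlgType R).
Variable iota : complexification L M.
Implicit Types (nu : involution L) (z : M).

Lemma cemb_mem x : iota x \in limg iota.
Proof. exact: memv_img (memvf x). Qed.

Fact cemb_closed x y : x \in limg iota -> y \in limg iota ->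
  bracket x y \in limg iota.
Proof.
move=> /memv_imgP[a _ ->] /memv_imgP[b _ ->].
by rewrite -cemb_bracket cemb_mem.
Qed.

Definition cemb_form : real_form M := RealForm cemb_closed (cemb_real iota).

(* z = iota (re_part z) + 'J (iota (im_part z)), see re_imP. *)
Definition re_part : 'Hom(M, L) :=
  (iota^-1 \o daddv_pi (limg iota) ('J @: limg iota))%VF.
Definition im_part : 'Hom(M, L) :=
  (- (iota^-1 \o 'J \o daddv_pi ('J @: limg iota) (limg iota)))%VF.

Lemma cembK x : (iota^-1)%VF (iota x) = x.
Proof. by apply: lker0_lfunK; apply/lker0P; apply: cemb_inj. Qed.

Lemma re_imE x y : re_part (iota x + 'J (iota y)) = x /\
                   im_part (iota x + 'J (iota y)) = y.
Proof.
have [UJ dUJ] := cemb_real iota.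
have JyU : 'J (iota y) \in ('J @: limg iota)%VS by rewrite memv_img ?cemb_mem.
have dJU : ('J @: limg iota :&: limg iota = 0)%VS by rewrite capvC.
have p0 V W (v : M) : (V :&: W = 0)%VS -> v \in V -> daddv_pi W V v = 0.
  move=> d vV; have := daddv_pi_add d (subvP (addvSl V W) _ vV).
  by rewrite daddv_pi_id // => /(canRL (addKr _)); rewrite addNr.
rewrite /re_part /im_part opp_lfunE !comp_lfunE !linearD /=.
rewrite (daddv_pi_id dUJ (cemb_mem x)) (p0 _ _ _ dUJ (cemb_mem x)).
rewrite (daddv_pi_id dJU JyU) (p0 _ _ _ dJU JyU) cstructK !linear0 !linearN /=.
by rewrite !cembK addr0 add0r opprK.
Qed.

Lemma reE x y : re_part (iota x + 'J (iota y)) = x.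
Proof. by have [] := re_imE x y. Qed.
Lemma imE x y : im_part (iota x + 'J (iota y)) = y.
Proof. by have [] := re_imE x y. Qed.

Lemma re_imP z : z = iota (re_part z) + 'J (iota (im_part z)).
Proof.
have [_ [_ [/memv_imgP[x _ ->] /memv_imgP[y _ ->] ->]]] :=
  @rf_decomp _ _ cemb_form z.
by rewrite reE imE.
Qed.

Variant re_im_spec : M -> Type := ReIm x y : re_im_spec (iota x + 'J (iota y)).
Lemma re_im z : re_im_spec z. Proof. by rewrite [z]re_imP. Qed.

(* The C-linear extension of a linear endomorphism of L. *)
Definition cextend (f : 'End(L)) : 'End(M) :=
  ((iota \o f \o re_part) + ('J \o iota \o f \o im_part))%VF.

Lemma cextendE f x y :
  cextend f (iota x + 'J (iota y)) = iota (f x) + 'J (iota (f y)).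
Proof.
by rewrite add_lfunE; congr +%R; rewrite 2!comp_lfunE ?reE // comp_lfunE imE.
Qed.

Lemma cextend_emb f x : cextend f (iota x) = iota (f x).
Proof. by have := cextendE f x 0; rewrite !linear0 !addr0. Qed.

Lemma cextendJ f z : cextend f ('J z) = 'J (cextend f z).
Proof.
have E u v : 'J (iota u + 'J (iota v)) = iota (- v) + 'J (iota u).
  by rewrite linearD /= cstructK -linearN addrC.
by case: (re_im z) => x y; rewrite E !cextendE E linearN.
Qed.

Lemma emb_bracketE x y x' y' :
  bracket (iota x + 'J (iota y)) (iota x' + 'J (iota y')) =
  iota (bracket x x' - bracket y y')
    + 'J (iota (bracket x y' + bracket y x')).
Proof.
rewrite bracketCE -!cemb_bracket.
by congr (_ + 'J _); rewrite ?linearB ?linearD.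
Qed.

Section Extend.
Variable nu : involution L.

Fact cext_bracket z z' :
  cextend nu (bracket z z') = bracket (cextend nu z) (cextend nu z').
Proof.
case: (re_im z) => x y; case: (re_im z') => x' y'.
rewrite emb_bracketE !cextendE emb_bracketE -!inv_bracket.
by congr (iota _ + 'J (iota _)); rewrite ?linearB ?linearD.
Qed.
Fact cext_square z : cextend nu (cextend nu z) = z.
Proof. by case: (re_im z) => x y; rewrite !cextendE !inv_square. Qed.

Definition extension : involution M := Involution cext_bracket cext_square.

(* L^nu + sqrt(-1) L^{-nu} *)
Definition twisted_space : {vspace M} :=
  (iota @: plus_space nu + 'J @: (iota @: minus_space nu))%VS.

Lemma twisted_spaceE :
  twisted_space = plus_space (conjugation (limg iota) \o cextend nu)%VF.
Proof.
have C x y : (conjugation (limg iota) \o cextend nu)%VF (iota x + 'J (iota y)) =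
    iota (nu x) + 'J (iota (- nu y)).
  by rewrite comp_lfunE cextendE (@conjugationE _ _ cemb_form) ?cemb_mem //
    !linearN.
apply/vspaceP => z; apply/idP/plus_spaceP.
  case/memv_addP => _ /memv_imgP[x /plus_spaceP xp ->].
  case=> _ /memv_imgP[_ /memv_imgP[y /minus_spaceP yp ->] ->] ->.
  by rewrite C xp yp opprK.
case: (re_im z) => x y; rewrite C => E.
have := congr1 re_part E; rewrite !reE => xp.
have := congr1 im_part E; rewrite !imE => yp.
apply: memv_add; rewrite ?memv_img //; first exact/plus_spaceP.
by apply/minus_spaceP; rewrite -{2}yp opprK.
Qed.

Fact twist_tau_bracket x y (tau := (conjugation (limg iota) \o cextend nu)%VF) :
  tau (bracket x y) = bracket (tau x) (tau y).
Proof.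
by rewrite !comp_lfunE cext_bracket (@conjugation_bracket _ _ cemb_form).
Qed.
Fact twist_tauJ x (tau := (conjugation (limg iota) \o cextend nu)%VF) :
  tau ('J x) = - 'J (tau x).
Proof. by rewrite !comp_lfunE cextendJ (@conjugationJ _ _ cemb_form). Qed.
Lemma twist_conjC x :
  conjugation (limg iota) (cextend nu x) = cextend nu (conjugation (limg iota) x).
Proof.
case: (re_im x) => a b.
rewrite cextendE !(@conjugationE _ _ cemb_form) ?cemb_mem // -!linearN /=.
by rewrite cextendE !linearN.
Qed.
Fact twist_tauK x (tau := (conjugation (limg iota) \o cextend nu)%VF) :
  tau (tau x) = x.
Proof.
by rewrite !comp_lfunE -twist_conjC (@conjugationK _ _ cemb_form) cext_square.
Qed.

Fact twisted_bracket x y : x \in twisted_space -> y \in twisted_space ->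
  bracket x y \in twisted_space.
Proof. by rewrite twisted_spaceE; apply: fixed_bracket twist_tau_bracket x y. Qed.
Fact twisted_real : is_real_form twisted_space.
Proof.
by rewrite twisted_spaceE; apply: fixed_real; [apply: twist_tauJ | apply: twist_tauK].
Qed.

Definition twisted_form : real_form M := RealForm twisted_bracket twisted_real.

Lemma twistedP z : reflect (cextend nu z = conjugation (limg iota) z)
                           (z \in twisted_form).
Proof.
rewrite /= twisted_spaceE; apply: (iffP (plus_spaceP _ _)); rewrite comp_lfunE.
  by move=> {2}<-; rewrite (@conjugationK _ _ cemb_form).
by move=> ->; rewrite (@conjugationK _ _ cemb_form).
Qed.

End Extend.

Lemma cextend_comm nu nu' z : (nu \o nu' = nu' \o nu)%VF ->
  cextend nu (cextend nu' z) = cextend nu' (cextend nu z).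
Proof.
move=> c; have cE x : nu (nu' x) = nu' (nu x).
  by have /lfunP/(_ x) := c; rewrite !comp_lfunE.
by case: (re_im z) => x y; rewrite !cextendE !cE.
Qed.

Lemma twisted_stable nu nu' z : (nu \o nu' = nu' \o nu)%VF ->
  z \in twisted_form nu -> extension nu' z \in twisted_form nu.
Proof.
move=> c /twistedP zE; apply/twistedP => /=.
by rewrite cextend_comm // zE twist_conjC.
Qed.

Lemma killing_trace (f : 'End(M)) (h : 'End(L)) :
    (forall x y, f (iota x + 'J (iota y)) = iota (h x) + 'J (iota (h y))) ->
  lfun_trace f = lfun_trace h *+ 2 /\ lfun_trace ('J \o f)%VF = 0.
Proof.
move=> fE; have -> : f = cextend h.
  by apply/lfunP => z; case: (re_im z) => x y; rewrite fE cextendE.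
have reI : (re_part \o iota = \1)%VF.
  apply/lfunP => x; rewrite comp_lfunE id_lfunE.
  by have := reE x 0; rewrite !linear0 addr0.
have imI : (im_part \o iota = 0)%VF.
  apply/lfunP => x; rewrite comp_lfunE zero_lfunE.
  by have := imE x 0; rewrite !linear0 addr0.
have reJ : (re_part \o ('J \o iota) = 0)%VF.
  apply/lfunP => x; rewrite comp_lfunE [('J \o _)%VF x]comp_lfunE zero_lfunE.
  by have := reE 0 x; rewrite !linear0 add0r.
have imJ : (im_part \o ('J \o iota) = \1)%VF.
  apply/lfunP => x; rewrite comp_lfunE [('J \o _)%VF x]comp_lfunE id_lfunE.
  by have := imE 0 x; rewrite !linear0 add0r.
have T (W : 'Hom(L, M)) (p : 'Hom(M, L)) :
    lfun_trace (W \o h \o p)%VF = lfun_trace (h \o (p \o W))%VF.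
  by rewrite -comp_lfunA lfun_traceC comp_lfunA.
split.
  by rewrite lfun_traceD T reI T imJ !comp_lfun1r mulr2n.
have -> : ('J \o cextend h =
           ('J \o iota \o h \o re_part) - (iota \o h \o im_part))%VF.
  apply/lfunP => z; rewrite comp_lfunE add_lfunE opp_lfunE.
  case: (re_im z) => x y; rewrite cextendE linearD /= cstructK.
  by congr (_ - _); rewrite 2!comp_lfunE ?imE // comp_lfunE reE.
rewrite lfun_traceD lfun_traceN !T reJ imI !comp_lfun0r.
have -> : lfun_trace (0 : 'End(L)) = 0.
  by apply: big1 => i _; rewrite zero_lfunE linear0.
by rewrite subr0.
Qed.

Lemma killing_emb x y :
  killing (iota x) (iota y) = killing x y *+ 2 /\
  killing ('J (iota x)) (iota y) = 0.
Proof.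
have [|E1 E2] := @killing_trace (ad (iota x) \o ad (iota y))%VF
  (ad x \o ad y)%VF.
  move=> a b; rewrite !comp_lfunE !adE !bracketDr !bracketJr.
  by rewrite -!cemb_bracket.
split=> //; rewrite -E2 /killing comp_lfunA; congr lfun_trace.
by congr comp_lfun; apply/lfunP => v; rewrite comp_lfunE !adE bracketJl.
Qed.

End Complexification.

Section KillingReal.
Variables (R : realType) (M : cplxLieAlgType R).

Lemma killingJJ (x y : M) : killing ('J x) ('J y) = - killing x y.
Proof.
rewrite /killing -lfun_traceN; congr lfun_trace; apply/lfunP => v.
by rewrite opp_lfunE !comp_lfunE !adE !bracketJl bracketJr cstructK.
Qed.

Section Incl.
Variable U : real_form M.

Fact rf_incl_bracket (x y : rf_lie U) :
  linfun vsval (bracket x y) = bracket (linfun vsval x) (linfun vsval y) :> M.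
Proof. by rewrite !lfunE /= val_bracket. Qed.
Fact rf_incl_inj : injective (linfun vsval : 'Hom(rf_lie U, M)).
Proof. by move=> x y; rewrite !lfunE => /subvs_inj. Qed.
Lemma rf_incl_limg : limg (linfun vsval : 'Hom(rf_lie U, M)) = U.
Proof.
apply/vspaceP => z; apply/memv_imgP/idP => [[x _ ->]|zU].
  by rewrite lfunE /= subvsP.
by exists (vsproj U z); rewrite ?memvf // lfunE /= vsprojK.
Qed.
Fact rf_incl_real : is_real_form (limg (linfun vsval : 'Hom(rf_lie U, M))).
Proof. by rewrite rf_incl_limg; apply: rf_real. Qed.

Definition rf_incl : complexification (rf_lie U) M :=
  Complexification rf_incl_bracket rf_incl_inj rf_incl_real.

Lemma rf_inclE x : rf_incl x = vsval x. Proof. by rewrite lfunE. Qed.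

Lemma killing_rf (x y : rf_lie U) :
  killing (vsval x) (vsval y) = killing x y *+ 2.
Proof. by rewrite -!rf_inclE; have [] := killing_emb rf_incl x y. Qed.

End Incl.

Lemma cartan_of_conj (u V : real_form M) (nu : involution M)
    (nuV : forall x, x \in V -> nu x \in V) :
    (forall x, x \in u -> x != 0 -> killing x x < 0) ->
    (forall x, x \in V -> nu x = conjugation u x) ->
  cartan_involution (restriction nuV).
Proof.
move=> neg nuE x x0; rewrite oppr_gt0 -(pmulrn_llt0 _ (isT : 0 < 2)%N).
rewrite -killing_rf val_res // nuE ?subvsP //.
have {x0} : vsval x != 0.
  by apply: contra x0 => /eqP e; apply/eqP/subvs_inj; rewrite e linear0.
have [a [b [au bu ->]]] := rf_decomp u (vsval x); move=> ab0.
rewrite conjugationE // killingDl !killingDr !killingNr killingJJ opprK.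
rewrite (killingC a) (_ : _ + _ = killing a a + killing b b); last by ring.
have le0 c : c \in u -> killing c c <= 0.
  by have [->|c0 cu] := eqVneq c 0; [rewrite killing0 | apply/ltW/neg].
have [a0|a0] := eqVneq a 0; last by rewrite ltr_wnDr ?le0 ?neg.
have b0 : b != 0.
  by apply: contra ab0 => /eqP ->; rewrite a0 linear0 addr0.
by rewrite ltr_wnDl ?le0 ?neg.
Qed.

End KillingReal.

Section Twist.
Variables (R : realType) (L : lieAlgType R) (M : cplxLieAlgType R).
Variable iota : complexification L M.

Lemma cartan_twisted_compact (theta : involution L) :
    cartan_involution theta ->
  forall z : M, z \in twisted_form iota theta -> z != 0 -> killing z z < 0.
Proof.
move=> ct z; case/memv_addP => _ /memv_imgP[p /plus_spaceP tp ->].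
case=> _ /memv_imgP[_ /memv_imgP[q /minus_spaceP tq ->] ->] -> pq0.
have inv x y : killing (theta x) (theta y) = killing x y.
  rewrite /killing.
  have -> : (ad (theta x) \o ad (theta y)
             = theta \o ((ad x \o ad y) \o theta))%VF.
    apply/lfunP => v; rewrite !comp_lfunE !adE !inv_bracket.
    by rewrite inv_square.
  rewrite lfun_traceC; congr lfun_trace; apply/lfunP => v.
  by rewrite !comp_lfunE inv_square.
have [Epp _] := killing_emb iota p p; have [Eqq _] := killing_emb iota q q.
have [_ Eqp] := killing_emb iota q p.
rewrite killingDl !killingDr (killingC _ ('J _)) Eqp killingJJ Epp Eqq.
rewrite addr0 add0r -mulrnBl pmulrn_llt0 //.
have np : killing p p = killing p (theta p) by rewrite tp.
have nq : - killing q q = killing q (theta q) by rewrite tq killingNr.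
rewrite np nq.
have le0 x : killing x (theta x) <= 0.
  have [->|/ct] := eqVneq x 0; first by rewrite linear0 killing0.
  by rewrite oppr_gt0 => /ltW.
have lt0 x : x != 0 -> killing x (theta x) < 0 by move/ct; rewrite oppr_gt0.
have [p0|p0] := eqVneq p 0; last by rewrite ltr_wnDr ?le0 ?lt0.
have q0 : q != 0 by apply: contra pq0 => /eqP->; rewrite p0 !linear0 addr0.
by rewrite ltr_wnDl ?le0 ?lt0.
Qed.

Lemma limg_compact : compact_semisimple L ->
  forall z : M, z \in cemb_form iota -> z != 0 -> killing z z < 0.
Proof.
move=> cpt _ /memv_imgP[x _ ->] x0.
have [-> _] := killing_emb iota x x; rewrite pmulrn_llt0 // cpt //.
by apply: contra x0 => /eqP ->; rewrite linear0.
Qed.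

End Twist.

(* The complexification of L, with (x, y) standing for x + sqrt(-1) y. *)
Definition cplx (R : realType) (L : lieAlgType R) : Type := (L * L)%type.

Section Cplx.
Variables (R : realType) (L : lieAlgType R).

HB.instance Definition _ := Vector.on (cplx L).

Definition cplx_bracket (z w : cplx L) : cplx L :=
  (bracket z.1 w.1 - bracket z.2 w.2, bracket z.1 w.2 + bracket z.2 w.1).

Definition cplx_J (z : cplx L) : cplx L := (- z.2, z.1).

Fact cplx_bracketl (w : cplx L) a (u v : cplx L) :
  cplx_bracket (a *: u + v) w = a *: cplx_bracket u w + cplx_bracket v w.
Proof.
congr pair => /=; rewrite !bracket_is_linearl ?scalerBr ?scalerDr.
  by rewrite opprD addrACA.
by rewrite addrACA.
Qed.
Fact cplx_bracketr (w : cplx L) a (u v : cplx L) :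
  cplx_bracket w (a *: u + v) = a *: cplx_bracket w u + cplx_bracket w v.
Proof.
congr pair => /=; rewrite !bracket_is_linearr ?scalerBr ?scalerDr.
  by rewrite opprD addrACA.
by rewrite addrACA.
Qed.
Fact cplx_bracketxx (z : cplx L) : cplx_bracket z z = 0.
Proof.
by congr pair => /=; rewrite ?bracketxx ?subr0 // bracketC addNr.
Qed.
Fact cplx_jacobi (x y z : cplx L) :
  cplx_bracket x (cplx_bracket y z) + cplx_bracket y (cplx_bracket z x)
    + cplx_bracket z (cplx_bracket x y) = 0.
Proof.
congr pair => /=; rewrite !bracketDr ?bracketNr ?opprD !addrA.
  rewrite [LHS](ACl ((1*5*9)*(2*8*11)*(3*6*12)*(4*7*10)))/=.
  by rewrite -!opprD !jacobi !oppr0 !addr0.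
rewrite [LHS](ACl ((1*6*11)*(2*7*9)*(3*5*10)*(4*8*12)))/=.
by rewrite -!opprD !jacobi !oppr0 !addr0.
Qed.

HB.instance Definition _ := isLieAlgebra.Build R (cplx L)
  cplx_bracketl cplx_bracketr cplx_bracketxx cplx_jacobi.

Fact cplx_J_linear : linear cplx_J.
Proof. by move=> a u v; congr pair => /=; rewrite opprD scalerN. Qed.
HB.instance Definition _ :=
  GRing.isLinear.Build R (cplx L) (cplx L) *:%R cplx_J cplx_J_linear.

Fact cplx_JK (z : cplx L) : linfun cplx_J (linfun cplx_J z) = - z.
Proof. by rewrite !lfunE. Qed.
Fact cplx_bracketJ (z w : cplx L) :
  bracket (linfun cplx_J z) w = linfun cplx_J (bracket z w).
Proof.
by rewrite !lfunE; congr pair => /=; rewrite bracketNl ?opprD addrC.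
Qed.

HB.instance Definition _ :=
  hasComplexStructure.Build R (cplx L) cplx_JK cplx_bracketJ.

Definition cplx_real (x : L) : cplx L := (x, 0).
Fact cplx_real_linear : linear cplx_real.
Proof. by move=> a u v; congr pair => /=; rewrite scaler0 addr0. Qed.
HB.instance Definition _ :=
  GRing.isLinear.Build R L (cplx L) *:%R cplx_real cplx_real_linear.

Fact cplx_real_bracket x y : linfun cplx_real (bracket x y) =
  bracket (linfun cplx_real x) (linfun cplx_real y) :> cplx L.
Proof.
by rewrite !lfunE; congr pair;
  rewrite /= ?linear0 ?(oppr0, addr0, add0r) // bracketC linear0 oppr0.
Qed.
Fact cplx_real_inj : injective (linfun cplx_real).
Proof. by move=> x y; rewrite !lfunE => -[]. Qed.
Fact cplx_real_form : is_real_form (limg (linfun cplx_real)).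
Proof.
have JE (x y : L) : 'J ((x, y) : cplx L) = (- y, x) by apply: lfunE.
have rE x : linfun cplx_real x = (x, 0) by rewrite lfunE.
split.
  apply/vspaceP => -[x y]; rewrite memvf.
  have -> : (x, y) = linfun cplx_real x + 'J (linfun cplx_real y) :> cplx L.
    by rewrite !rE JE; congr pair; rewrite /= ?oppr0 ?addr0 ?add0r.
  by rewrite memv_add ?memv_img ?memvf.
apply/eqP; rewrite -subv0; apply/subvP => z; rewrite memv_cap => /andP[].
move=> /memv_imgP[x _ ->] /memv_imgP[_ /memv_imgP[y _ ->]].
by rewrite !rE JE => -[-> _]; rewrite oppr0 mem0v.
Qed.

Definition cplx_emb : complexification L (cplx L) :=
  Complexification cplx_real_bracket cplx_real_inj cplx_real_form.

End Cplx.

Record triad (R : realType) (g : lieAlgType R) := Triad {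
  triad_compact : compact_semisimple g;
  triad_theta1 : involution g;
  triad_theta2 : involution g;
  triad_comm : (triad_theta1 \o triad_theta2 = triad_theta2 \o triad_theta1)%VF
}.

Arguments triad_compact {R g}.

Section Triad.
Variables (R : realType) (g : lieAlgType R) (t : triad g).

(* (g, theta1, theta1 theta2) *)
Definition triad_assoc : triad g :=
  Triad (triad_compact t) (inv_comp_comm (triad_comm t)).

(* (g, theta2, theta1) *)
Definition triad_dual : triad g :=
  Triad (triad_compact t) (esym (triad_comm t)).

End Triad.

(* A semisimple symmetric pair equipped with a Cartan involution
   (g0, sigma; theta), where g0 is a real form of M and M is identified with the
   complexification of g0 (see rf_incl).
   Non-compactness of g0, which amounts to theta != id, is not imposed: it is
   not preserved by the duality operations on trivial involutions (triad_star
   is compact if theta1 = id, pair_dual is compact if sigma = id). *)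
Record cartan_pair (R : realType) (M : cplxLieAlgType R) := CartanPair {
  pair_form : real_form M;
  pair_sigma : involution (rf_lie pair_form);
  pair_theta : involution (rf_lie pair_form);
  pair_semisimple : semisimple (rf_lie pair_form);
  pair_cartan : cartan_involution pair_theta;
  pair_comm : (pair_theta \o pair_sigma = pair_sigma \o pair_theta)%VF
}.

Arguments pair_semisimple {R M}.
Arguments pair_cartan {R M}.

Section Pair.
Variables (R : realType) (M : cplxLieAlgType R) (p : cartan_pair M).

(* (g0, theta sigma; theta) *)
Definition pair_assoc : cartan_pair M :=
  @CartanPair _ _ (pair_form p) (inv_comp (pair_comm p)) (pair_theta p)
    (pair_semisimple p) (pair_cartan p) (inv_comp_comm (pair_comm p)).

Let iota := rf_incl (pair_form p).

(* The compact real form g0^theta + sqrt(-1) g0^{-theta}. *)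
Definition compact_dual : real_form M := twisted_form iota (pair_theta p).

Definition pair_mu : 'End(M) := conjugation compact_dual.
Definition pair_mu_sigma : 'End(M) := (pair_mu \o extension iota (pair_sigma p))%VF.

Lemma pair_mu_theta z :
  pair_mu (extension iota (pair_theta p) z) =
  extension iota (pair_theta p) (pair_mu z).
Proof.
have st w : w \in compact_dual ->
    extension iota (pair_theta p) w \in compact_dual.
  exact: twisted_stable.
have [a [b [au bu ->]]] := rf_decomp compact_dual z.
rewrite {2}/pair_mu conjugationE // linearD linearB /= !cextendJ.
by rewrite conjugationE ?st.
Qed.

Lemma pair_mu_sigmaC z :
  pair_mu (extension iota (pair_sigma p) z) =
  extension iota (pair_sigma p) (pair_mu z).
Proof.
have st w : w \in compact_dual ->
    extension iota (pair_sigma p) w \in compact_dual.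
  exact: twisted_stable (pair_comm p).
have [a [b [au bu ->]]] := rf_decomp compact_dual z.
rewrite {2}/pair_mu conjugationE // linearD linearB /= !cextendJ.
by rewrite conjugationE ?st.
Qed.

Fact mu_sigma_bracket x y :
  pair_mu_sigma (bracket x y) = bracket (pair_mu_sigma x) (pair_mu_sigma y).
Proof. by rewrite !comp_lfunE inv_bracket conjugation_bracket. Qed.
Fact mu_sigmaJ x : pair_mu_sigma ('J x) = - 'J (pair_mu_sigma x).
Proof. by rewrite !comp_lfunE /= cextendJ conjugationJ. Qed.
Fact mu_sigmaK x : pair_mu_sigma (pair_mu_sigma x) = x.
Proof. by rewrite !comp_lfunE -pair_mu_sigmaC conjugationK inv_square. Qed.

(* g0^d, the fixed point set of mu sigma. *)
Definition dual_form : real_form M :=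
  fixed_form mu_sigma_bracket mu_sigmaJ mu_sigmaK.

Lemma dual_formP z : z \in dual_form ->
  extension iota (pair_sigma p) z = pair_mu z.
Proof.
move=> /plus_spaceP; rewrite comp_lfunE => {2}<-.
by rewrite conjugationK.
Qed.

Fact dual_sigma_stable z : z \in dual_form ->
  extension iota (pair_sigma p) z \in dual_form.
Proof.
move=> zd; apply/plus_spaceP; rewrite comp_lfunE inv_square.
by rewrite -dual_formP.
Qed.

Fact dual_theta_stable z : z \in dual_form ->
  extension iota (pair_theta p) z \in dual_form.
Proof.
move=> zd; apply/plus_spaceP; rewrite comp_lfunE /=.
rewrite (cextend_comm _ _ (esym (pair_comm p))).
rewrite -[cextend iota (pair_sigma p) z]/(extension iota (pair_sigma p) z).
rewrite dual_formP // -[cextend _ _]/(inv_fun (extension iota (pair_theta p))).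
by rewrite pair_mu_theta conjugationK.
Qed.

Fact dual_cartan : cartan_involution (restriction dual_sigma_stable).
Proof.
apply: (@cartan_of_conj _ _ compact_dual); last exact: dual_formP.
exact: cartan_twisted_compact (pair_cartan p).
Qed.

Fact dual_comm :
  (restriction dual_sigma_stable \o restriction dual_theta_stable =
   restriction dual_theta_stable \o restriction dual_sigma_stable)%VF.
Proof.
by apply: restriction_comm => z; apply: cextend_comm; rewrite (pair_comm p).
Qed.

(* (g0^d, theta; sigma) *)
Definition pair_dual : cartan_pair M :=
  @CartanPair _ _ dual_form (restriction dual_theta_stable)
    (restriction dual_sigma_stable) (cartan_semisimple dual_cartan)
    dual_cartan dual_comm.

End Pair.

Section Star.
Variables (R : realType) (g : lieAlgType R) (t : triad g).

Let iota := cplx_emb g.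

(* g^theta1 + sqrt(-1) g^{-theta1} *)
Definition star_form : real_form (cplx g) := twisted_form iota (triad_theta1 t).

Fact star_theta1_stable z : z \in star_form ->
  extension iota (triad_theta1 t) z \in star_form.
Proof. exact: twisted_stable. Qed.
Fact star_theta2_stable z : z \in star_form ->
  extension iota (triad_theta2 t) z \in star_form.
Proof. exact: twisted_stable (triad_comm t). Qed.

Fact star_cartan : cartan_involution (restriction star_theta1_stable).
Proof.
apply: (@cartan_of_conj _ _ (cemb_form iota)).
  exact: limg_compact (triad_compact t).
by move=> z /twistedP.
Qed.

Fact star_comm :
  (restriction star_theta1_stable \o restriction star_theta2_stable =
   restriction star_theta2_stable \o restriction star_theta1_stable)%VF.
Proof.
by apply: restriction_comm => z; apply: cextend_comm; rewrite (triad_comm t).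
Qed.

(* (g^theta1 + sqrt(-1) g^{-theta1}, theta2; theta1), the involutions being
   extended C-linearly to cplx g and then restricted. *)
Definition triad_star : cartan_pair (cplx g) :=
  @CartanPair _ _ star_form (restriction star_theta2_stable)
    (restriction star_theta1_stable) (cartan_semisimple star_cartan)
    star_cartan star_comm.

End Star.

(* Main.v *)
Require Import Defs.
From mathcomp Require Import all_boot all_order all_algebra.
From mathcomp Require Import reals.
From mathcomp Require Import boolp.

(** All the pairs in question live in one complex Lie algebra [cplx g], and a
    pair is determined by its real form together with the C-linear extensions
    of its two involutions ([cartan_pair_eq]).  On the triad side these
    extensions are those of [theta1], [theta2] and [theta1 theta2], since
    restricting a C-linear involution to a real form and extending it again
    gives it back ([extension_restriction]), and extension respects
    composition ([extension_comp]).

    This settles the associated pair, whose real form depends on [theta1]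
    only.  For the dual pair the two real forms have to be compared.  A real
    form is the fixed point set of its conjugation, and the conjugation of
    g^theta1 + sqrt(-1) g^{-theta1} is [theta1] followed by the conjugation of
    g ([conjugation_twisted]).  Twisting by the involution [theta1] once more
    therefore undoes the first twist: the compact form used to define the dual
    pair is g again ([twisted_twisted]), and [mu] is the conjugation of g.  The
    fixed points of [mu theta2] are then g^theta2 + sqrt(-1) g^{-theta2}, which
    is the real form of the star of the dual triad. *)

Set Implicit Arguments.
Unset Strict Implicit.
Unset Printing Implicit Defensive.

Import GRing.Theory.
Local Open Scope ring_scope.

Section RealForms.
Variables (R : realType) (M : cplxLieAlgType R).
Implicit Type U : real_form M.

(** M is the direct sum of U and 'J U, so an antilinear map is known once it is
    known on U. *)
Lemma conjugation_unique U (tau : 'End(M)) :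
    (forall z, tau ('J z) = - 'J (tau z)) -> (forall x, x \in U -> tau x = x) ->
  conjugation U = tau.
Proof.
move=> tauJ tauU; apply/lfunP => z.
have [x [y [xU yU ->]]] := rf_decomp U z.
by rewrite conjugationE // linearD /= tauJ !tauU.
Qed.

Lemma conjugation_fixedP U z : reflect (conjugation U z = z) (z \in U).
Proof.
apply: (iffP idP) => [zU|zE].
  by have := conjugationE zU (mem0v U); rewrite !linear0 !addr0.
have [x [y [xU yU zxy]]] := rf_decomp U z.
move: zE; rewrite zxy conjugationE // => /addrI /eqP.
rewrite eq_sym -addr_eq0 -mulr2n -scaler_nat scaler_eq0 Num.Theory.pnatr_eq0.
by move=> /= /eqP->; rewrite addr0.
Qed.

(** Comparing the involutions of two pairs on M avoids transporting them along
    the equality of the two real forms, which are different types. *)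
Lemma cartan_pair_eq (p q : cartan_pair M) :
    rf_space (pair_form p) = rf_space (pair_form q) ->
    (forall z, extension (rf_incl (pair_form p)) (pair_sigma p) z =
               extension (rf_incl (pair_form q)) (pair_sigma q) z) ->
    (forall z, extension (rf_incl (pair_form p)) (pair_theta p) z =
               extension (rf_incl (pair_form q)) (pair_theta q) z) ->
  p = q.
Proof.
case: p q => [U s t ss ct c] [V s' t' ss' ct' c'] /= /real_form_eq UV.
subst V => sE tE.
have inj (nu nu' : involution (rf_lie U)) :
    (forall z, cextend (rf_incl U) nu z = cextend (rf_incl U) nu' z) -> nu = nu'.
  move=> E; apply: involution_eq => x.
  by have := E (rf_incl U x); rewrite !cextend_emb => /cemb_inj.
have := inj _ _ sE; have := inj _ _ tE => ? ?; subst s' t'.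
by congr CartanPair; apply: Prop_irrelevance.
Qed.

End RealForms.

Section Twists.
Variables (R : realType) (L : lieAlgType R) (M : cplxLieAlgType R).
Variable iota : complexification L M.

Lemma extension_comp (nu nu' : involution L)
    (c : (nu \o nu' = nu' \o nu)%VF) z :
  extension iota (inv_comp c) z = extension iota nu (extension iota nu' z).
Proof.
by rewrite /=; case: (re_im iota z) => x y; rewrite !cextendE !comp_lfunE.
Qed.

(** Restriction loses nothing, since a C-linear map on M is determined by its
    values on a real form. *)
Lemma extension_restriction (U : real_form M) (nu : involution L)
    (nuU : forall x, x \in U -> extension iota nu x \in U) z :
  extension (rf_incl U) (restriction nuU) z = extension iota nu z.
Proof.
rewrite /=; case: (re_im (rf_incl U) z) => x y.
rewrite cextendE !rf_inclE !(val_restriction nuU) /= -cextendJ.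
exact: esym (linearD (cextend iota nu) _ _).
Qed.

(** The twist is defined as a sum of eigenspaces, but it is also the set of
    points fixed by this antilinear map, which is therefore its conjugation. *)
Lemma conjugation_twisted (nu : involution L) :
  conjugation (twisted_form iota nu) =
    (conjugation (limg iota) \o cextend iota nu)%VF.
Proof.
apply: conjugation_unique => [z|x]; first exact: twist_tauJ.
by move=> /twistedP xE; rewrite comp_lfunE xE (@conjugationK _ _ (cemb_form iota)).
Qed.

(** The conjugation of the twist is [nu] composed with that of L, so on the
    points where it agrees with [nu] the factor [nu] cancels, and only the
    fixed points of the conjugation of L remain. *)
Lemma twisted_twisted (nu : involution L)
    (st : forall z, z \in twisted_form iota nu ->
                    extension iota nu z \in twisted_form iota nu) :
  rf_space (twisted_form (rf_incl (twisted_form iota nu)) (restriction st)) =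
    limg iota.
Proof.
set U := twisted_form iota nu; apply/vspaceP => z.
have extE : cextend (rf_incl U) (restriction st) z = cextend iota nu z.
  exact: (extension_restriction st z).
have conjE : conjugation (limg (rf_incl U)) z =
    cextend iota nu (conjugation (limg iota) z).
  rewrite [limg _](rf_incl_limg U) conjugation_twisted comp_lfunE.
  exact: twist_conjC.
apply/twistedP/(conjugation_fixedP (cemb_form iota)); rewrite extE conjE.
  by move=> /(congr1 (extension iota nu)); rewrite /= !cext_square.
by move=> ->.
Qed.

End Twists.

Theorem proposition3p11 (R : realType) (g : lieAlgType R) (t : triad g) :
  triad_star (triad_assoc t) = pair_assoc (triad_star t) /\
  triad_star (triad_dual t) = pair_dual (triad_star t).
Proof.
split; apply: cartan_pair_eq.
- by [].
- move=> z; rewrite [RHS]extension_comp [LHS]extension_restriction extension_comp.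
  by rewrite ![in RHS]extension_restriction.
- by [].
- rewrite /= /pair_mu_sigma /pair_mu /compact_dual twisted_twisted.
  rewrite twisted_spaceE; congr plus_space; congr (_ \o _)%VF.
  by apply/lfunP => z; rewrite extension_restriction.
- (* The involutions of the dual pair are restrictions of extensions of
     restrictions, hence the repeated rewriting. *)
  by move=> z; rewrite !extension_restriction.
- by move=> z; rewrite !extension_restriction.
Qed.
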